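(* Let $n\ge 3$ and let $R$ be a ring whose stable rank satisfies $1<\mathrm{sr}(R)<n$. Let $\sigma\in \mathrm{GL}_n(R)$, let $i,j,k,l\in\{1,\dots,n\}$ with $i\neq j$ and $k\neq l$, and let $a,b,c\in R$. Then (i) $t_{kl}(a\sigma_{ij}b)$ is a product of $16$ $\mathrm{E}_n(R)$-conjugates of $\sigma$ and $\sigma^{-1}$, and (ii) $t_{kl}(a(c\sigma_{ii}-\sigma_{jj}c)b)$ is a product of $48$ $\mathrm{E}_n(R)$-conjugates of $\sigma$ and $\sigma^{-1}$.
   Context: Rings are associative with $1\neq 0$, not necessarily commutative. A row $u=(u_1,\dots,u_m)$ over $R$ is unimodular if there is a column $v$ of length $m$ over $R$ with $uv=1$. The stable rank $\mathrm{sr}(R)$ is the least positive integer $m$ such that for any $p\ge m$ and any unimodular row $(u_1,\dots,u_{p+1})$ over $R$ there are $x_1,\dots,x_p\in R$ such that $(u_1+u_{p+1}x_1,\dots,u_p+u_{p+1}x_p)$ is unimodular ($\mathrm{sr}(R)=\infty$ if no such $m$ exists). $\mathrm{GL}_n(R)$ is the group of invertible $n\times n$ matrices over $R$; $\sigma_{ij}$ is the $(i,j)$ entry of $\sigma$. For $i\ne j$ and $x\in R$, $t_{ij}(x)=e+xe^{ij}$, where $e$ is the identity matrix and $e^{ij}$ is the matrix with $1$ at position $(i,j)$ and $0$ elsewhere. $\mathrm{E}_n(R)$ is the subgroup of $\mathrm{GL}_n(R)$ generated by all $t_{ij}(x)$ ($i\neq j$, $x\in R$). For $g,h$ in a group,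 $g^h=h^{-1}gh$. ''A product of $m$ $\mathrm{E}_n(R)$-conjugates of $\sigma$ and $\sigma^{-1}$'' means a product of $m$ factors, each of the form $\sigma^{\xi}$ or $(\sigma^{-1})^{\xi}$ with $\xi\in \mathrm{E}_n(R)$. *)

(* Defs.v *)
From HB Require Import structures.
From mathcomp Require Import all_boot all_algebra.

Set Implicit Arguments.
Unset Strict Implicit.
Unset Printing Implicit Defensive.

Import GRing.Theory.
Local Open Scope ring_scope.

(* [unitmx] needs a commutative ring, so an element of GL_n(R) is encoded as a
   matrix together with its two-sided inverse; by [GL_inj] the matrix alone
   determines the element. *)
Definition inverse_pair (R : nzRingType) (n : nat)
    (p : 'M[R]_n * 'M[R]_n) : bool :=
  (p.1 *m p.2 == 1%:M) && (p.2 *m p.1 == 1%:M).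

Record GL (R : nzRingType) (n : nat) : Type := MkGL {
  GL_pair : 'M[R]_n * 'M[R]_n;
  GL_pairP : inverse_pair GL_pair
}.

HB.instance Definition _ (R : nzRingType) (n : nat) :=
  [isSub for @GL_pair R n].
HB.instance Definition _ (R : nzRingType) (n : nat) :=
  [Choice of GL R n by <:].

Definition GL_mx (R : nzRingType) (n : nat) (g : GL R n) : 'M[R]_n :=
  (GL_pair g).1.
Coercion GL_mx : GL >-> matrix.

Lemma GL_inj (R : nzRingType) (n : nat) : injective (@GL_mx R n).
Proof.
move=> [[A A'] /= hA] [[B B'] /= hB]; rewrite /GL_mx /= => eqAB.
apply: val_inj; subst B => /=; congr pair.
have /andP[_ /eqP/= A'A] := hA; have /andP[/eqP/= AB' _] := hB.
by rewrite -[B']mul1mx -A'A -mulmxA AB' mulmx1.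
Qed.

Fact GL_one_subproof (R : nzRingType) (n : nat) :
  inverse_pair (1%:M : 'M[R]_n, 1%:M : 'M[R]_n).
Proof. by rewrite /inverse_pair /= mulmx1 eqxx. Qed.
Definition GL_one (R : nzRingType) (n : nat) : GL R n :=
  MkGL (@GL_one_subproof R n).

Fact GL_inv_subproof (R : nzRingType) (n : nat) (g : GL R n) :
  inverse_pair ((GL_pair g).2, (GL_pair g).1).
Proof. by have := GL_pairP g; rewrite /inverse_pair /= andbC. Qed.
Definition GL_inv (R : nzRingType) (n : nat) (g : GL R n) : GL R n :=
  MkGL (GL_inv_subproof g).

Fact GL_mul_subproof (R : nzRingType) (n : nat) (g h : GL R n) :
  inverse_pair ((GL_pair g).1 *m (GL_pair h).1,
                (GL_pair h).2 *m (GL_pair g).2).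
Proof.
case: g h => [[A A'] /= /andP[/eqP/= AA' /eqP/= A'A]].
case=> [[B B'] /= /andP[/eqP/= BB' /eqP/= B'B]].
apply/andP; split => /=; apply/eqP.
  by rewrite mulmxA -(mulmxA A) BB' mulmx1 AA'.
by rewrite mulmxA -(mulmxA B') A'A mulmx1 B'B.
Qed.
Definition GL_mul (R : nzRingType) (n : nat) (g h : GL R n) : GL R n :=
  MkGL (GL_mul_subproof g h).

Fact GL_mulA (R : nzRingType) (n : nat) : associative (@GL_mul R n).
Proof. by move=> g h k; apply: GL_inj; rewrite /GL_mx /= mulmxA. Qed.
Fact GL_mul1 (R : nzRingType) (n : nat) :
  left_id (@GL_one R n) (@GL_mul R n).
Proof. by move=> g; apply: GL_inj; rewrite /GL_mx /= mul1mx. Qed.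
Fact GL_mulV (R : nzRingType) (n : nat) :
  left_inverse (@GL_one R n) (@GL_inv R n) (@GL_mul R n).
Proof.
by move=> g; apply: GL_inj; rewrite /GL_mx /=; case/andP: (GL_pairP g) => _ /eqP.
Qed.
Fact GL_muln1 (R : nzRingType) (n : nat) :
  right_id (@GL_one R n) (@GL_mul R n).
Proof. by move=> g; apply: GL_inj; rewrite /GL_mx /= mulmx1. Qed.
Fact GL_mulnV (R : nzRingType) (n : nat) :
  right_inverse (@GL_one R n) (@GL_inv R n) (@GL_mul R n).
Proof.
by move=> g; apply: GL_inj; rewrite /GL_mx /=; case/andP: (GL_pairP g) => /eqP.
Qed.

HB.instance Definition _ (R : nzRingType) (n : nat) :=
  isGroup.Build (GL R n) (@GL_mulA R n) (@GL_mul1 R n) (@GL_muln1 R n)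
    (@GL_mulV R n) (@GL_mulnV R n).

Lemma GL_mx1 (R : nzRingType) (n : nat) : GL_mx (1%g : GL R n) = 1%:M.
Proof. by []. Qed.
Lemma GL_mxM (R : nzRingType) (n : nat) (g h : GL R n) :
  GL_mx (g * h)%g = GL_mx g *m GL_mx h.
Proof. by []. Qed.
Lemma GL_mxVl (R : nzRingType) (n : nat) (g : GL R n) :
  GL_mx g^-1%g *m GL_mx g = 1%:M.
Proof. by rewrite -GL_mxM mulVg. Qed.
Lemma GL_mxVr (R : nzRingType) (n : nat) (g : GL R n) :
  GL_mx g *m GL_mx g^-1%g = 1%:M.
Proof. by rewrite -GL_mxM mulgV. Qed.

Definition transvection_mx (R : nzRingType) (n : nat) (i j : 'I_n) (x : R) :
    'M[R]_n :=
  1%:M + x *: delta_mx i j.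

Lemma transvection_mxD (R : nzRingType) (n : nat) (i j : 'I_n) (x y : R) :
  i != j ->
  transvection_mx i j x *m transvection_mx i j y = transvection_mx i j (x + y).
Proof.
move=> neq_ij; rewrite /transvection_mx mulmxDl mul1mx mulmxDr mulmx1.
rewrite -scalemxAl; suff -> : delta_mx i j *m (y *: delta_mx i j) = 0 :> 'M[R]_n.
  by rewrite scaler0 addr0 scalerDl -addrA [y *: _ + _]addrC.
apply/matrixP=> p q; rewrite !mxE big1 // => r _; rewrite !mxE.
case: (r =P j) => [->|_]; last by rewrite andbF mul0r.
by rewrite [j == i]eq_sym (negbTE neq_ij) /= mulr0 mulr0.
Qed.

Fact transvection_subproof (R : nzRingType) (n : nat) (i j : 'I_n)
    (neq_ij : i != j) (x : R) :
  inverse_pair (transvection_mx i j x, transvection_mx i j (- x)).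
Proof.
by rewrite /inverse_pair /= !transvection_mxD // addrN addNr
           /transvection_mx scale0r addr0 eqxx.
Qed.
Definition transvection (R : nzRingType) (n : nat) (i j : 'I_n)
    (neq_ij : i != j) (x : R) : GL R n :=
  MkGL (transvection_subproof neq_ij x).

Inductive generated (G : groupType) (S : G -> Prop) : G -> Prop :=
| generated_gen (g : G) : S g -> generated S g
| generated_one : generated S 1%g
| generated_mul (g h : G) :
    generated S g -> generated S h -> generated S (g * h)%g
| generated_inv (g : G) : generated S g -> generated S g^-1%g.

Definition is_transvection (R : nzRingType) (n : nat) (g : GL R n) : Prop :=
  exists (i j : 'I_n) (neq_ij : i != j) (x : R), g = transvection neq_ij x.

Definition En (R : nzRingType) (n : nat) : GL R n -> Prop :=
  generated (@is_transvection R n).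

(* The factors are multiplied in increasing order of their index;
   [g ^ h] is [h^-1 * g * h]. *)
Definition product_of_En_conjugates (R : nzRingType) (n : nat) (m : nat)
    (sigma tau : GL R n) : Prop :=
  exists (eps : 'I_m -> bool) (xi : 'I_m -> GL R n),
    (forall q : 'I_m, En (xi q)) /\
    tau = (\prod_(q < m)
             ((if eps q then sigma else sigma^-1) ^ xi q))%g.

Definition unimodular (R : nzRingType) (m : nat) (u : 'rV[R]_m) : Prop :=
  exists v : 'cV[R]_m, u *m v = 1%:M.

Definition stable_range (R : nzRingType) (m : nat) : Prop :=
  forall p : nat, (m <= p)%N -> forall u : 'rV[R]_p.+1, unimodular u ->
  exists x : 'I_p -> R,
    unimodular (\row_(i < p)
      (u 0 (widen_ord (leqnSn p) i) + u 0 ord_max * x i)).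

(* [sr_eq R m] reads sr(R) = m; it fails for every [m] when sr(R) is infinite. *)
Definition sr_eq (R : nzRingType) (m : nat) : Prop :=
  [/\ (0 < m)%N, stable_range R m
    & forall m' : nat, (0 < m')%N -> stable_range R m' -> (m <= m')%N].

(* Main.v *)
Require Import Defs.
From mathcomp Require Import all_boot all_algebra.

Set Implicit Arguments.
Unset Strict Implicit.
Unset Printing Implicit Defensive.

Import GRing.Theory.
Local Open Scope ring_scope.

(** Call T(c, r) = 1 + c r, for a column c and a row r with r c = 0, a rank one
    transvection.  Commuting a product of m conjugates of sigma and its inverse
    with an element of E_n costs 2m conjugates, so three nested commutators
    starting from sigma cost 8.  The proof finds two such triple commutators and
    multiplies them.

    Start from tau in E_n and A = sigma tau sigma^-1.  A double commutator of
    sigma with tau^-1 and then with t in E_n is, up to conjugation, the product of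
    a conjugate of t^-1 by A and a conjugate of t by tau
    ([cprod_double_commg]).  The second factor is explicit, the first
    is not, because A contains unknown entries of sigma.  The last commutator
    is taken with an element that commutes with everything unknown; what is left
    is an explicit transvection.  There are two ways to do this, both based on
    a row f and a column z with f sigma z = 0.
    - If tau = T(z, w), then A fixes the row f, so the unknown factor lies in the
      abelian group of all T(c, f); this extracts the pairing f z
      ([cprod_kernel_pairing]).
    - If tau = T(z, a f sigma), then A = T(sigma z, a f), which fixes every column
      y killed by f; this extracts the values f sigma y of the row f sigma
      ([cprod_row_value]).

    Let i <> j.  By stable range, conjugation by some T(e_j, X) makes the row i of
    sigma, without its entry at j, unimodular; sigma_ij does not change.  Let u be
    the new row.  There is now a column x with x_j = 0 and u x = sigma_ij, and
    after one more conjugation, by T(- x, e_j), the pair f = e_i - x_i e_j, z = e_j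
    satisfies f sigma z = 0.  In
      sigma_ij = u_i x_i + (u x - u_i x_i)
    the factor x_i = - f z of the first term comes from the first extraction,
    while the second term is a value of f sigma on a column vanishing at i and j
    and comes from the second extraction: 8 + 8 = 16 conjugates.

    Statement (ii) follows from (i), since the entry (j, i) of the conjugate of
    sigma by t_ji(c) is
      sigma_ji + sigma_jj c - c sigma_ii - c sigma_ij c,
    which writes c sigma_ii - sigma_jj c as a sum of three off-diagonal terms:
    3 * 16 = 48. *)

(** * Products of elementary conjugates *)

Section ConjugateProducts.
Variables (R : nzRingType) (n : nat).
Implicit Types (sigma tau t g h xi : GL R n).

Lemma En_conj g h : En g -> En h -> En (g ^ h)%g.
Proof.
move=> Eg Eh; rewrite conjgE; apply: generated_mul; first exact: generated_inv.
exact: generated_mul.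
Qed.

Lemma cprod_conj1 sigma xi :
  En xi -> product_of_En_conjugates 1 sigma (sigma ^ xi)%g.
Proof. by move=> Exi; exists xpredT, (fun=> xi); rewrite big_ord1. Qed.

Lemma cprodM m p sigma g h :
    product_of_En_conjugates m sigma g -> product_of_En_conjugates p sigma h ->
  product_of_En_conjugates (m + p) sigma (g * h)%g.
Proof.
move=> [eps1 [xi1 [E1 ->]]] [eps2 [xi2 [E2 ->]]].
exists (fun q => match split q with inl a => eps1 a | inr b => eps2 b end).
exists (fun q => match split q with inl a => xi1 a | inr b => xi2 b end).
split=> [q|]; first by case: (split q).
rewrite big_split_ord; congr (_ * _)%g; apply: eq_bigr => q _.
  by rewrite (unsplitK (inl q)).
by rewrite (unsplitK (inr q)).
Qed.

Lemma cprodJ m sigma g xi :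
    En xi -> product_of_En_conjugates m sigma g ->
  product_of_En_conjugates m sigma (g ^ xi)%g.
Proof.
move=> Exi [eps [eta [E ->]]]; exists eps, (fun q => eta q * xi)%g.
split=> [q|]; first exact: generated_mul (E q) Exi.
by rewrite conjg_prod; apply: eq_bigr => q _; rewrite conjgM.
Qed.

Lemma cprodV m sigma g :
  product_of_En_conjugates m sigma g -> product_of_En_conjugates m sigma g^-1%g.
Proof.
elim: m g => [|m IHm] g [eps [xi [E ->]]].
  by exists eps, xi; split=> //; rewrite !big_ord0 invg1.
have tailP : product_of_En_conjugates m sigma (\prod_(q < m)
    ((if eps (lift ord0 q) then sigma else sigma^-1) ^ xi (lift ord0 q)))^-1%g.
  by apply: IHm; exists (fun q => eps (lift ord0 q)), (fun q => xi (lift ord0 q)).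
have headP : product_of_En_conjugates 1 sigma
    ((if eps ord0 then sigma else sigma^-1) ^ xi ord0)^-1%g.
  exists (fun=> ~~ eps ord0), (fun=> xi ord0); split=> //.
  by rewrite big_ord1 -conjVg; case: (eps ord0); rewrite /= ?invgK.
by rewrite big_ord_recl invgM; have := cprodM tailP headP; rewrite addn1.
Qed.

Lemma cprod_of_conj m sigma xi g :
    En xi -> product_of_En_conjugates m (sigma ^ xi)%g g ->
  product_of_En_conjugates m sigma g.
Proof.
move=> Exi [eps [eta [E ->]]]; exists eps, (fun q => xi * eta q)%g.
split=> [q|]; first exact: generated_mul Exi (E q).
apply: eq_bigr => q _; rewrite conjgM.
by case: (eps q); rewrite ?conjVg.
Qed.

Lemma cprod_commg m sigma g t :
    En t -> product_of_En_conjugates m sigma g ->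
  product_of_En_conjugates (m + m) sigma [~ g, t]%g.
Proof.
by move=> Et gP; rewrite commgEl; apply: cprodM; [apply: cprodV | apply: cprodJ].
Qed.

(** This is the commutator of [~ sigma^-1, tau^-1] and t, conjugated by tau so
    that all of sigma sits in the single exponent A = sigma tau sigma^-1. *)
Lemma cprod_double_commg sigma tau t :
    En tau -> En t ->
  product_of_En_conjugates 4 sigma (t^-1 ^ (tau ^ sigma^-1) * t ^ tau)%g.
Proof.
move=> Etau Et.
have V g : En g -> En g^-1%g by exact: generated_inv.
have sP : product_of_En_conjugates 1 sigma (sigma^-1)%g.
  apply: cprodV; rewrite -[X in product_of_En_conjugates _ _ X]conjg1.
  exact/cprod_conj1/generated_one.
have := cprodJ Etau (cprod_commg Et (cprod_commg (V _ Etau) sP)).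
congr (product_of_En_conjugates _ _ _).
by rewrite /commg !conjgE !invgM !invgK !mulgA mulVg mul1g.
Qed.

End ConjugateProducts.

(** This is how an unknown factor p disappears: it is enough to know that it
    commutes with t. *)
Lemma commMg_cancel (G : groupType) (p q t : G) :
  commute p t -> [~ p * q, t]%g = [~ q, t]%g.
Proof.
move=> /commuteV cptV; rewrite /commg !conjgE invgM -!mulgA (mulgA t^-1%g).
by rewrite -cptV -mulgA mulKg.
Qed.

(** * Rank one transvections *)

Section RankOne.
Variables (R : nzRingType) (n : nat).
Implicit Types (g sigma : GL R n) (c z y k : 'cV[R]_n) (r f w : 'rV[R]_n).

(** Total in c and r, so that terms carry no proof of r c = 0; the value is
    meaningful only under that condition, and defaults to 1 when 1 - c r is not
    inverse to 1 + c r. *)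
Definition rank1 c r : GL R n := insubd (1%g : GL R n)
  ((1%:M + c *m r, 1%:M - c *m r) : 'M[R]_n * 'M[R]_n).

Lemma rank1_mx c r : r *m c = 0 -> rank1 c r = 1%:M + c *m r :> 'M_n.
Proof.
move=> rc0; suff P : inverse_pair ((1%:M + c *m r, 1%:M - c *m r) : 'M[R]_n * 'M[R]_n).
  by rewrite /GL_mx -[GL_pair _]/(val _) insubdK.
have crcr : c *m r *m (c *m r) = 0 by rewrite mulmxA -(mulmxA c) rc0 mulmx0 mul0mx.
rewrite /inverse_pair /= !mulmxDl !mulmxDr !mulmxN !mulNmx !mul1mx !mulmx1 crcr.
by rewrite oppr0 !addr0 subrK addrK eqxx.
Qed.

Lemma rank1Dl c c' r :
  r *m c = 0 -> r *m c' = 0 -> (rank1 c r * rank1 c' r)%g = rank1 (c + c') r.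
Proof.
move=> rc rc'; have rD : r *m (c + c') = 0 by rewrite mulmxDr rc rc' addr0.
apply: GL_inj; rewrite GL_mxM !rank1_mx //.
rewrite mulmxDl mul1mx mulmxDr mulmx1 -mulmxA (mulmxA r) rc' mul0mx mulmx0 addr0.
by rewrite mulmxDl -addrA [_ + c *m r]addrC.
Qed.

Lemma rank1Dr c r r' :
  r *m c = 0 -> r' *m c = 0 -> (rank1 c r * rank1 c r')%g = rank1 c (r + r').
Proof.
move=> rc r'c; have rD : (r + r') *m c = 0 by rewrite mulmxDl rc r'c addr0.
apply: GL_inj; rewrite GL_mxM !rank1_mx //.
rewrite mulmxDl mul1mx mulmxDr mulmx1 -mulmxA (mulmxA r) rc mul0mx mulmx0 addr0.
by rewrite mulmxDr -addrA [_ + c *m r]addrC.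
Qed.

Lemma rank1_0l r : rank1 0 r = 1%g.
Proof. by apply: GL_inj; rewrite rank1_mx ?mulmx0 // mul0mx addr0. Qed.

Lemma rank1_0r c : rank1 c 0 = 1%g.
Proof. by apply: GL_inj; rewrite rank1_mx ?mul0mx // mulmx0 addr0. Qed.

Lemma rank1V c r : r *m c = 0 -> (rank1 c r)^-1%g = rank1 (- c) r.
Proof.
move=> rc; apply: mulg1_eq; rewrite rank1Dl ?mulmxN ?rc ?oppr0 //.
by rewrite subrr rank1_0l.
Qed.

Lemma rank1J c r g :
  r *m c = 0 -> (rank1 c r ^ g)%g = rank1 (GL_mx g^-1%g *m c) (r *m g).
Proof.
move=> rc; apply: GL_inj; rewrite conjgE !GL_mxM !rank1_mx //.
  by rewrite mulmxDl mul1mx mulmxDr GL_mxVl !mulmxA.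
by rewrite -mulmxA (mulmxA (GL_mx g)) GL_mxVr mul1mx.
Qed.

Lemma rank1J_rank1 c r c' r' :
    r *m c = 0 -> r' *m c' = 0 ->
  (rank1 c r ^ rank1 c' r')%g =
    rank1 (c - c' *m (r' *m c)) (r + r *m c' *m r').
Proof.
move=> rc rc'; rewrite rank1J // rank1V // !rank1_mx ?mulmxN ?rc' ?oppr0 //.
by rewrite mulmxDl mul1mx mulmxDr mulmx1 !mulNmx !mulmxA.
Qed.

Lemma rank1_scalar c r (M : 'M[R]_1) : rank1 (c *m M) r = rank1 c (M *m r).
Proof. by rewrite /rank1 mulmxA. Qed.

Lemma rank1_commute c r c' r' :
    r *m c = 0 -> r' *m c' = 0 -> r *m c' = 0 -> r' *m c = 0 ->
  commute (rank1 c r) (rank1 c' r').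
Proof.
move=> rc r'c' rc' r'c; apply: GL_inj; rewrite !GL_mxM !rank1_mx //.
rewrite !mulmxDl !mulmxDr !mul1mx !mulmx1 -(mulmxA c) (mulmxA r) rc'.
by rewrite -(mulmxA c') (mulmxA r') r'c !mul0mx !mulmx0 !addr0 -!addrA [X in _ + X]addrC.
Qed.

Lemma rank1_commgl c r c' r' :
    r *m c = 0 -> r' *m c' = 0 -> r *m c' = 0 ->
  [~ rank1 c r, rank1 c' r']%g = rank1 (- c' *m (r' *m c)) r.
Proof.
move=> rc r'c' rc'; rewrite commgEl rank1J // !rank1V // !rank1_mx ?mulmxN ?r'c' ?oppr0 //.
rewrite mulmxDl mul1mx mulmxDr mulmx1 [r *m (c' *m r')]mulmxA rc' mul0mx addr0.
rewrite rank1Dl ?addKr ?mulmxA // ?mulmxDr ?mulmxA ?mulmxN ?mulNmx;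
  by rewrite rc ?rc' ?mul0mx ?oppr0 ?addr0.
Qed.

Lemma rank1_commgr c r c' r' :
    r *m c = 0 -> r' *m c' = 0 -> r' *m c = 0 ->
  [~ rank1 c r, rank1 c' r']%g = rank1 c (r *m c' *m r').
Proof.
move=> rc r'c' r'c; rewrite commgEl rank1J // !rank1V // !rank1_mx ?mulmxN ?r'c' ?oppr0 //.
rewrite mulmxDl mul1mx -(mulmxA _ r') r'c mulmx0 addr0.
have rx : r *m c' *m r' *m c = 0 by rewrite -!mulmxA r'c !mulmx0.
rewrite mulmxDr mulmx1 mulmxA -(rank1Dr rc rx) mulgA rank1Dl ?mulmxN ?rc ?oppr0 //.
by rewrite addNr rank1_0l mul1g.
Qed.

(** * Two triple commutators *)

(** With tau = T(z, w), the element A = sigma tau sigma^-1 fixes the row f because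
    f sigma z = 0.  Hence the double commutator with t = T(y, f) equals
    T(C, f) T(y, f z w), where only the column C = y - A^-1 y is unknown, and
    T(C, f) commutes with T(k, f). *)
Lemma cprod_kernel_pairing sigma f w z y k :
    f *m sigma *m z = 0 -> w *m z = 0 -> f *m y = 0 -> w *m y = 0 ->
    f *m k = 0 -> En (rank1 z w) -> En (rank1 y f) -> En (rank1 k f) ->
  product_of_En_conjugates 8 sigma
    (rank1 y (f *m z *m (w *m k) *m f)).
Proof.
move=> fsz wz fy wy fk Ezw Eyf Ekf.
have := cprod_commg Ekf (cprod_double_commg sigma Ezw Eyf).
congr (product_of_En_conjugates _ _ _).
set A := (rank1 z w ^ _)%g.
have fA : f *m A = f.
  rewrite /A rank1J // invgK rank1_mx; last first.
    by rewrite -mulmxA (mulmxA _ sigma) GL_mxVl mul1mx.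
  by rewrite mulmxDr mulmx1 !mulmxA fsz !mul0mx addr0.
have fNy : f *m - y = 0 by rewrite mulmxN fy oppr0.
have fAVy : f *m - (GL_mx A^-1%g *m y) = 0.
  by rewrite mulmxN -{1}fA mulmxA -(mulmxA f) GL_mxVr mulmx1 fy oppr0.
have fzwy : f *m z *m w *m y = 0 by rewrite -mulmxA wy mulmx0.
rewrite rank1V // rank1J // rank1J // fA rank1V // !rank1_mx ?mulmxN ?wz ?oppr0 //.
rewrite mulmxDl mul1mx -(mulmxA _ w) wy mulmx0 addr0.
rewrite mulmxDr mulmx1 mulmxA -rank1Dr // mulgA rank1Dl //.
have fC : f *m (- (GL_mx A^-1%g *m y) + y) = 0 by rewrite mulmxDr fAVy fy addr0.
rewrite commMg_cancel; last exact: rank1_commute.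
by rewrite rank1_commgr // !mulmxA.
Qed.

(** With tau = T(z, a f sigma), the element A = sigma tau sigma^-1 is
    T(sigma z, a f), which fixes y.  The double commutator with t = T(y, r)
    is T(- y, v) T(c, r), where v is an unknown multiple of f and c contains the
    value f sigma y.  The element T(k, r') commutes with the first factor, since
    f k = 0 and r' y = 0, and its commutator with the second is T(- k r' c, r). *)
Lemma cprod_row_value sigma f r r' z y k (a : 'M[R]_1) :
    f *m sigma *m z = 0 -> f *m y = 0 -> r *m y = 0 -> r *m z = 0 ->
    r' *m y = 0 -> f *m k = 0 -> r *m k = 0 -> r' *m k = 0 ->
    En (rank1 z (a *m f *m sigma)) -> En (rank1 y r) -> En (rank1 k r') ->
  product_of_En_conjugates 8 sigma
    (rank1 (k *m (r' *m z) *m a *m (f *m sigma *m y)) r).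
Proof.
move=> fsz fy ry rz r'y fk rk r'k Ez Ey Ek.
have := cprod_commg Ek (cprod_double_commg sigma Ez Ey).
congr (product_of_En_conjugates _ _ _).
set u := a *m f *m sigma.
have uz : u *m z = 0 by rewrite /u -!mulmxA (mulmxA f) fsz mulmx0.
set A := (rank1 z u ^ _)%g.
have uV : u *m GL_mx sigma^-1%g = a *m f.
  by rewrite /u -mulmxA GL_mxVr mulmx1.
have afs : a *m f *m (sigma *m z) = 0 by rewrite mulmxA.
have AE : A = rank1 (sigma *m z) (a *m f) by rewrite /A rank1J // invgK uV.
have Ay : GL_mx A^-1%g *m y = y.
  rewrite AE rank1V // rank1_mx; last by rewrite mulmxN afs oppr0.
  by rewrite mulmxDl mul1mx -(mulmxA _ _ y) -(mulmxA a) fy !mulmx0 addr0.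
have rNy : r *m - y = 0 by rewrite mulmxN ry oppr0.
pose v := r *m sigma *m z *m (a *m f).
have vy : v *m y = 0 by rewrite /v -!mulmxA fy !mulmx0.
have vNy : v *m - y = 0 by rewrite mulmxN vy oppr0.
pose c := - z *m u *m y.
have rc : r *m c = 0 by rewrite /c !mulmxA mulmxN rz oppr0 !mul0mx.
rewrite rank1V // rank1J // rank1J // mulmxN Ay AE rank1_mx // rank1V //.
rewrite !rank1_mx ?mulmxN ?uz ?oppr0 //.
rewrite [_ *m y]mulmxDl mul1mx [r *m _]mulmxDr [r *m (1%:M + z *m u)]mulmxDr !mulmx1.
rewrite !(mulmxA r) rz mul0mx addr0 -(mulmxA _ a).
rewrite [r + _]addrC -/v -/c -(rank1Dr vNy rNy) -(rank1Dl ry rc) mulgA.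
rewrite -(mulgA (rank1 _ v)) rank1Dl // addNr rank1_0l mulg1.
have r'Ny : r' *m - y = 0 by rewrite mulmxN r'y oppr0.
have vk : v *m k = 0 by rewrite /v -!mulmxA fk !mulmx0.
rewrite commMg_cancel; last exact: rank1_commute.
by rewrite rank1_commgl // /c /u !mulNmx mulmxN mulmxN opprK !mulmxA.
Qed.

End RankOne.

(** * Stable range at an arbitrary position *)

(** The stable range condition discards the last entry of a row.  Reordering the
    columns lets it discard any entry j; the vanishing of X and V at j says that
    entry j stays as it is and no longer serves for unimodularity. *)
Lemma stable_range_row (R : nzRingType) (s n : nat) (u : 'rV[R]_n) (j : 'I_n) :
    stable_range R s -> (s < n)%N -> unimodular u ->
  exists X : 'rV[R]_n, exists V : 'cV[R]_n,
    [/\ X 0 j = 0, V j 0 = 0 & (u + (u 0 j)%:M *m X) *m V = 1%:M].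
Proof.
case: n u j => // p u j srR lesp [v uv].
pose h (q : 'I_p.+1) := if unlift ord_max q is Some i then lift j i else j.
have hL i : h (lift ord_max i) = lift j i by rewrite /h liftK.
have hM : h ord_max = j by rewrite /h unlift_none.
have wL (i : 'I_p) : widen_ord (leqnSn p) i = lift ord_max i.
  by apply: val_inj; rewrite /= /bump leqNgt ltn_ord.
have uni : unimodular (\row_q u 0 (h q)).
  exists (\col_q v (h q) 0); rewrite -uv; apply/matrixP=> a b; rewrite !ord1 !mxE.
  rewrite (bigD1_ord ord_max) // (bigD1_ord j) //= !mxE hM; congr (_ + _).
  by apply: eq_bigr => i _; rewrite !mxE hL.
have [x [w xw]] := srR p lesp _ uni.
(* Padding by 0 at j, so that no index type has to be changed. *)
exists (\row_q if unlift j q is Some i then x i else 0).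
exists (\col_q if unlift j q is Some i then w i 0 else 0).
rewrite !mxE unlift_none; split=> //.
rewrite -xw; apply/matrixP=> a b; rewrite !ord1 !mxE (bigD1_ord j) //= !mxE unlift_none.
rewrite mulr0 add0r; apply: eq_bigr => i _.
by rewrite !mxE big_ord1 !mxE liftK mulr1n wL hL hM.
Qed.

(** * Coordinates and elementary transvections *)

Section Coordinates.
Variables (R : nzRingType) (n : nat).
Implicit Types (g h t sigma : GL R n) (c y : 'cV[R]_n) (r : 'rV[R]_n).
Implicit Types (i j k l m : 'I_n) (a b x : R).

Local Notation "''c_' k" := (delta_mx k 0 : 'cV[R]_n) (at level 8, k at level 2).
Local Notation "''r_' k" := (delta_mx 0 k : 'rV[R]_n) (at level 8, k at level 2).

Lemma delta_row_mul l c : 'r_l *m c = (c l 0)%:M.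
Proof. by rewrite -rowE; apply/matrixP=> p q; rewrite !mxE !ord1 mulr1n. Qed.

Lemma mul_delta_col k r : r *m 'c_k = (r 0 k)%:M.
Proof. by rewrite -colE; apply/matrixP=> p q; rewrite !mxE !ord1 mulr1n. Qed.

Lemma delta_row_col k l : 'r_k *m 'c_l = (k == l)%:R%:M.
Proof. by rewrite delta_row_mul mxE andbT. Qed.

Lemma delta_row_colN k l : k != l -> 'r_k *m 'c_l = 0.
Proof. by move=> kl; rewrite delta_row_col (negbTE kl) raddf0. Qed.

Lemma mul_delta_col0 k r : r *m 'c_k = 0 -> r 0 k = 0.
Proof. by rewrite mul_delta_col => /matrixP/(_ 0 0); rewrite !mxE mulr1n. Qed.

Lemma delta_row_mul0 l c : 'r_l *m c = 0 -> c l 0 = 0.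
Proof. by rewrite delta_row_mul => /matrixP/(_ 0 0); rewrite !mxE mulr1n. Qed.

Lemma transvection_rank1 k l (neq_kl : k != l) x :
  transvection neq_kl x = rank1 ('c_k *m x%:M) 'r_l.
Proof.
apply: GL_inj; rewrite rank1_mx; last first.
  by rewrite mulmxA delta_row_colN 1?eq_sym // mul0mx.
congr (_ + _); apply/matrixP=> p q; rewrite !mxE big_ord1 !mxE big_ord1 !mxE mulr1n.
by case: (p == k); case: (q == l); rewrite ?mulr1 ?mul1r ?mulr0 ?mul0r ?mul0r.
Qed.

Lemma En_rank1_col c l : c l 0 = 0 -> En (rank1 c 'r_l).
Proof.
move=> cl0; pose P c := 'r_l *m c = 0 /\ En (rank1 c 'r_l).
suff []: P c by [].
have -> : c = \sum_p 'c_p *m (c p 0)%:M.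
  apply/matrixP=> q o; rewrite summxE (bigD1 q) //= ord1 !mxE big_ord1 !mxE eqxx.
  rewrite mul1r mulr1n big1 ?addr0 // => p /negPf pq.
  by rewrite !mxE big_ord1 !mxE [q == p]eq_sym pq mul0r.
apply: (big_ind P) => [|c1 c2 [rc1 E1] [rc2 E2]|p _].
- by split; rewrite ?mulmx0 // rank1_0l; exact: generated_one.
- by split; rewrite ?mulmxDr ?rc1 ?rc2 ?addr0 // -rank1Dl //; exact: generated_mul.
have [->|neq_pl] := eqVneq p l.
  by rewrite cl0 raddf0 mulmx0; split; rewrite ?mulmx0 // rank1_0l; exact: generated_one.
split; first by rewrite mulmxA delta_row_colN 1?eq_sym // mul0mx.
by rewrite -(transvection_rank1 neq_pl); apply: generated_gen; exists p, l, neq_pl, (c p 0).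
Qed.

Lemma En_rank1_row k r : r 0 k = 0 -> En (rank1 'c_k r).
Proof.
move=> rk0; pose P r := r *m 'c_k = 0 /\ En (rank1 'c_k r).
suff []: P r by [].
have -> : r = \sum_p (r 0 p)%:M *m 'r_p.
  apply/matrixP=> o q; rewrite summxE (bigD1 q) //= ord1 !mxE big_ord1 !mxE eqxx.
  rewrite mulr1 mulr1n big1 ?addr0 // => p /negPf pq.
  by rewrite !mxE big_ord1 !mxE [q == p]eq_sym pq mulr0.
apply: (big_ind P) => [|r1 r2 [rc1 E1] [rc2 E2]|p _].
- by split; rewrite ?mul0mx // rank1_0r; exact: generated_one.
- by split; rewrite ?mulmxDl ?rc1 ?rc2 ?addr0 // -rank1Dr //; exact: generated_mul.
have [->|neq_pk] := eqVneq p k.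
  by rewrite rk0 raddf0 mul0mx; split; rewrite ?mul0mx // rank1_0r; exact: generated_one.
split; first by rewrite -mulmxA delta_row_colN // mulmx0.
have neq_kp : k != p by rewrite eq_sym.
rewrite -rank1_scalar -(transvection_rank1 neq_kp).
by apply: generated_gen; exists k, p, neq_kp, (r 0 p).
Qed.

Lemma third_index i j : (3 <= n)%N -> i != j -> exists2 m, i != m & j != m.
Proof.
move=> n3 ij; have: (0 < #|~: [set i; j]|)%N.
  by rewrite cardsCs setCK card_ord cards2 ij subn_gt0.
by case/card_gt0P=> m; rewrite !inE negb_or => /andP[mi mj]; exists m; rewrite eq_sym.
Qed.

Definition En_conjugate g h := exists2 xi, En xi & (g ^ xi)%g = h.

Lemma En_conjugate_trans g h t :
  En_conjugate g h -> En_conjugate h t -> En_conjugate g t.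
Proof.
move=> [x Ex <-] [y Ey <-]; exists (x * y)%g; last by rewrite conjgM.
exact: generated_mul.
Qed.

(** Two transvections carry e_k to e_k + e_k' and then to e_k'. *)
Lemma En_conjugate_col k k' r (M : 'M[R]_1) :
    k != k' -> r *m 'c_k = 0 -> r *m 'c_k' = 0 ->
  En_conjugate (rank1 ('c_k *m M) r) (rank1 ('c_k' *m M) r).
Proof.
move=> kk' rk rk'; have k'k : k' != k by rewrite eq_sym.
apply: (@En_conjugate_trans _ (rank1 (('c_k + 'c_k') *m M) r)).
  exists (rank1 (- 'c_k') 'r_k); first by apply: En_rank1_col; rewrite !mxE (negPf kk') oppr0.
  rewrite rank1J_rank1 ?mulmxA ?mulmxN ?rk ?rk' ?mul0mx ?delta_row_colN ?oppr0 //.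
  by rewrite mul0mx addr0 !mulNmx opprK -(mulmxA _ 'r_k) delta_row_col eqxx mulmx1 mulmxDl.
exists (rank1 'c_k 'r_k'); first by apply: En_rank1_col; rewrite !mxE (negPf k'k).
rewrite rank1J_rank1 ?mulmxA ?mulmxDr ?rk ?rk' ?addr0 ?mul0mx ?delta_row_colN ?addr0 //.
rewrite -!(mulmxA _ 'r_k') delta_row_colN // mulmx0 add0r delta_row_col eqxx.
by rewrite mulmx1 mulmxDl addrAC subrr add0r.
Qed.

Lemma En_conjugate_row l l' c :
    l != l' -> 'r_l *m c = 0 -> 'r_l' *m c = 0 ->
  En_conjugate (rank1 c 'r_l) (rank1 c 'r_l').
Proof.
move=> ll' lc l'c.
have l'l : l' != l by rewrite eq_sym.
apply: (@En_conjugate_trans _ (rank1 c ('r_l + 'r_l'))).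
  exists (rank1 'c_l 'r_l'); first by apply: En_rank1_col; rewrite !mxE (negPf l'l).
  rewrite rank1J_rank1 ?(delta_row_colN l'l) //.
  by rewrite l'c mulmx0 subr0 delta_row_col eqxx mul1mx.
exists (rank1 (- 'c_l') 'r_l); first by apply: En_rank1_col; rewrite !mxE (negPf ll') oppr0.
rewrite rank1J_rank1 ?mulmxDl ?lc ?l'c ?addr0 // ?mulmxN ?(delta_row_colN ll') ?oppr0 //.
by rewrite mulmx0 subr0 mul0mx add0r delta_row_col eqxx mulNmx mul1mx addrAC subrr add0r.
Qed.

(** This needs three indices: when k' = l one has to move l away before k can be
    moved to k'. *)
Lemma En_conjugate_transvection k l k' l' (kl : k != l) (kl' : k' != l') x :
  (3 <= n)%N -> En_conjugate (transvection kl x) (transvection kl' x).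
Proof.
move=> n3.
have refl g : En_conjugate g g by exists 1%g; [exact: generated_one | rewrite conjg1].
have mvc p q o (po : p != o) (qo : q != o) :
    En_conjugate (transvection po x) (transvection qo x).
  have [pq|pq] := eqVneq p q; first by subst q; rewrite !transvection_rank1; exact: refl.
  rewrite !transvection_rank1; apply: En_conjugate_col => //;
    by apply: delta_row_colN; rewrite eq_sym.
have mvr p q o (op : o != p) (oq : o != q) :
    En_conjugate (transvection op x) (transvection oq x).
  have [pq|pq] := eqVneq p q; first by subst q; rewrite !transvection_rank1; exact: refl.
  rewrite !transvection_rank1; apply: En_conjugate_row => //;
    by rewrite mulmxA delta_row_colN ?mul0mx // eq_sym.
have [k'l|k'l] := eqVneq k' l; last first.
  exact: En_conjugate_trans (mvc _ _ _ kl k'l) (mvr _ _ _ k'l kl').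
subst k'.
have [m km lm] := third_index n3 kl.
apply: En_conjugate_trans (mvr _ _ _ kl km) _.
exact: En_conjugate_trans (mvc _ _ _ km lm) (mvr _ _ _ lm kl').
Qed.

Lemma cprod_transvection_index q sigma k l k' l' (kl : k != l) (kl' : k' != l') x :
    (3 <= n)%N -> product_of_En_conjugates q sigma (transvection kl x) ->
  product_of_En_conjugates q sigma (transvection kl' x).
Proof.
move=> n3; have [xi Exi <-] := En_conjugate_transvection kl kl' x n3.
exact: cprodJ.
Qed.

(** * The two terms of an entry *)

(** The pairing of f = e_i - al e_j with z = e_j is - al.  Conjugation by
    T(- e_i al, e_j) carries e_i to f, so that the elements T(y, f) which occur
    are elementary. *)
Lemma cprod_shear_coef sigma i j k l (ij : i != j) (kl : k != l) al a b :
    (3 <= n)%N -> ('r_i - al%:M *m 'r_j) *m sigma *m 'c_j = 0 ->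
  product_of_En_conjugates 8 sigma (transvection kl (a * al * b)).
Proof.
move=> n3; set f := _ - _ => fsj.
have ji : j != i by rewrite eq_sym.
have [m im jm] := third_index n3 ij.
have mi : m != i by rewrite eq_sym.
have mj : m != j by rewrite eq_sym.
pose h := rank1 ('c_i *m (- al)%:M) 'r_j.
have Eh : En h.
  by apply: En_rank1_col; rewrite !mxE big1 // => p _; rewrite !mxE (negPf ji) mul0r.
(* The sign of a compensates that of the pairing f e_j. *)
pose y := ('c_i *m al%:M + 'c_j) *m (- a)%:M.
have fE : 'r_i *m h = f.
  rewrite rank1_mx; last by rewrite mulmxA (delta_row_colN ji) mul0mx.
  by rewrite mulmxDr mulmx1 !mulmxA delta_row_col eqxx mul1mx raddfN mulNmx.
have yE : GL_mx h^-1%g *m 'c_j *m (- a)%:M = y.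
  rewrite rank1V ?rank1_mx; try by rewrite ?mulmxN mulmxA (delta_row_colN ji) mul0mx ?oppr0.
  by rewrite mulmxDl mul1mx -(mulmxA _ 'r_j) delta_row_col eqxx mulmx1 raddfN mulmxN opprK addrC.
have yfE (M : 'M_1) : rank1 y (M *m f) = (rank1 ('c_j *m (- a)%:M) (M *m 'r_i) ^ h)%g.
  rewrite rank1J; first by rewrite mulmxA yE -mulmxA fE.
  by rewrite -!mulmxA (mulmxA 'r_i) (delta_row_colN ij) mul0mx mulmx0.
have fy : f *m y = 0.
  by rewrite -fE -yE !mulmxA -(mulmxA 'r_i) GL_mxVr mulmx1 (delta_row_colN ij) mul0mx.
have my : 'r_m *m y = 0.
  by rewrite mulmxA mulmxDr mulmxA (delta_row_colN mi) (delta_row_colN mj) mul0mx addr0 mul0mx.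
have fm : f *m 'c_m = 0.
  by rewrite mulmxBl -mulmxA (delta_row_colN im) (delta_row_colN jm) mulmx0 subr0.
have fk : f *m ('c_m *m b%:M) = 0 by rewrite mulmxA fm mul0mx.
have fj : f *m 'c_j = (- al)%:M.
  by rewrite mulmxBl (delta_row_colN ij) -mulmxA delta_row_col eqxx mulmx1 sub0r raddfN.
have mk : 'r_m *m ('c_m *m b%:M) = b%:M.
  by rewrite mulmxA delta_row_col eqxx mul1mx.
have Emj : En (rank1 'c_j 'r_m).
  by exact/En_rank1_row/mul_delta_col0/delta_row_colN.
have Eyf : En (rank1 y f).
  rewrite -[f]mul1mx yfE mul1mx; apply: En_conj => //.
  by apply: En_rank1_col; rewrite !mxE big1 // => p _; rewrite !mxE (negPf ij) mul0r.
have Ekf : En (rank1 ('c_m *m b%:M) f).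
  rewrite rank1_scalar; apply/En_rank1_row/mul_delta_col0.
  by rewrite -mulmxA fm mulmx0.
have := cprod_kernel_pairing fsj (delta_row_colN mj) fy my fk Emj Eyf Ekf.
rewrite mk fj yfE => /(cprodJ (generated_inv Eh)); rewrite conjgK.
rewrite -rank1_scalar -!mulmxA -!scalar_mxM mulrA mulrNN -(transvection_rank1 ji).
exact: cprod_transvection_index.
Qed.

(** Here z = e_j, so the row f sigma vanishes at j and T(e_j, a f sigma) is
    elementary although f sigma is otherwise arbitrary. *)
Lemma cprod_shear_row_value sigma i j k l (ij : i != j) (kl : k != l) al a y :
    (3 <= n)%N -> ('r_i - al%:M *m 'r_j) *m sigma *m 'c_j = 0 ->
    y i 0 = 0 -> y j 0 = 0 ->
  product_of_En_conjugates 8 sigma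
    (transvection kl (a * (('r_i - al%:M *m 'r_j) *m sigma *m y) 0 0)).
Proof.
move=> n3; set f := _ - _ => fsj yi yj.
have ji : j != i by rewrite eq_sym.
have [m im jm] := third_index n3 ij.
have mi : m != i by rewrite eq_sym.
have riy : 'r_i *m y = 0 by rewrite delta_row_mul yi raddf0.
have rjy : 'r_j *m y = 0 by rewrite delta_row_mul yj raddf0.
have fy : f *m y = 0 by rewrite mulmxBl riy -mulmxA rjy mulmx0 subr0.
have fm : f *m 'c_m = 0.
  by rewrite mulmxBl -mulmxA (delta_row_colN im) (delta_row_colN jm) mulmx0 subr0.
have Ez : En (rank1 'c_j (a%:M *m f *m sigma)).
  by apply/En_rank1_row/mul_delta_col0; rewrite -!mulmxA (mulmxA f) fsj mulmx0.
have Ey : En (rank1 y 'r_i) by exact: En_rank1_col.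
have Em : En (rank1 'c_m 'r_j) by apply: En_rank1_col; rewrite !mxE (negPf jm).
have := cprod_row_value fsj fy riy (delta_row_colN ij) rjy fm (delta_row_colN im)
  (delta_row_colN jm) Ez Ey Em.
rewrite delta_row_col eqxx mulmx1 -mulmxA; set N := f *m sigma *m y.
rewrite {1}[N]mx11_scalar -scalar_mxM -(transvection_rank1 mi).
exact: cprod_transvection_index.
Qed.

Lemma transvectionD k l (kl : k != l) a b :
  (transvection kl a * transvection kl b)%g = transvection kl (a + b).
Proof. by apply: GL_inj; rewrite GL_mxM; exact: transvection_mxD. Qed.

(** * The entries of sigma *)

(** The two conjugations zeta and xi bring sigma to the form required by the two
    preceding lemmas.  Conjugation by zeta only changes row i by the column
    operation, because i differs from j. *)
Lemma cprod_offdiag s sigma i j k l (ij : i != j) (kl : k != l) a b :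
    (3 <= n)%N -> stable_range R s -> (s < n)%N ->
  product_of_En_conjugates 16 sigma (transvection kl (a * sigma i j * b)).
Proof.
move=> n3 srR ltsn.
have ji : j != i by rewrite eq_sym.
have uni : unimodular ('r_i *m sigma).
  exists (GL_mx sigma^-1%g *m 'c_i).
  by rewrite mulmxA -(mulmxA 'r_i) GL_mxVr mulmx1 delta_row_col eqxx.
have [X [V [Xj Vj]]] := stable_range_row j srR ltsn uni.
have sijE : ('r_i *m sigma) 0 j = sigma i j by rewrite -rowE mxE.
rewrite sijE => XV.
pose zeta := rank1 'c_j X.
have Xcj : X *m 'c_j = 0 by rewrite mul_delta_col Xj raddf0.
have Ezeta : En zeta by exact: En_rank1_row.
pose u := 'r_i *m sigma + (sigma i j)%:M *m X.
have rzV : 'r_i *m GL_mx zeta^-1%g = 'r_i.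
  rewrite rank1V // rank1_mx ?mulmxN ?Xcj ?oppr0 //.
  by rewrite mulmxDr mulmx1 mulNmx mulmxN mulmxA (delta_row_colN ij) mul0mx subr0.
have uE : 'r_i *m (sigma ^ zeta)%g = u.
  rewrite conjgE !GL_mxM mulmxA rzV rank1_mx // mulmxDr mulmx1 mulmxDr mulmxA.
  by rewrite mulmxA mul_delta_col sijE.
have uj : u *m 'c_j = (sigma i j)%:M.
  by rewrite mulmxDl -(mulmxA _ X) Xcj mulmx0 addr0 mul_delta_col sijE.
pose x := V *m (sigma i j)%:M.
have xj : 'r_j *m x = 0 by rewrite mulmxA delta_row_mul Vj raddf0 mul0mx.
have ux : u *m x = (sigma i j)%:M by rewrite mulmxA XV mul1mx.
pose xi := rank1 (- x) 'r_j.
have rjx : 'r_j *m - x = 0 by rewrite mulmxN xj oppr0.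
have Exi : En xi by exact/En_rank1_col/delta_row_mul0.
(* The row e_i becomes f = e_i - al e_j in the coordinates given by xi. *)
pose al := x i 0.
pose tau := ((sigma ^ zeta) ^ xi)%g.
have fE : 'r_i *m xi = 'r_i - al%:M *m 'r_j.
  by rewrite rank1_mx // mulmxDr mulmx1 mulNmx mulmxN mulmxA delta_row_mul.
have ftE : ('r_i - al%:M *m 'r_j) *m tau = u *m xi.
  by rewrite -fE -mulmxA -GL_mxM -conjgC GL_mxM mulmxA uE.
have ftj : ('r_i - al%:M *m 'r_j) *m tau *m 'c_j = 0.
  rewrite ftE rank1_mx // mulmxDr mulmx1 mulmxDl uj mulNmx mulmxN mulmxA ux mulNmx -mulmxA.
  by rewrite delta_row_col eqxx mulmx1 subrr.
pose y := (x - 'c_i *m al%:M) *m b%:M.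
have rjy : 'r_j *m y = 0.
  by rewrite mulmxA mulmxBr xj mulmxA (delta_row_colN ji) mul0mx subrr mul0mx.
have riy : 'r_i *m y = 0.
  by rewrite mulmxA mulmxBr delta_row_mul mulmxA delta_row_col eqxx mul1mx subrr mul0mx.
have uy : ('r_i - al%:M *m 'r_j) *m tau *m y = ((sigma i j - u 0 i * al) * b)%:M.
  rewrite ftE rank1_mx // mulmxDr mulmx1 mulmxDl mulNmx mulmxN mulNmx -!mulmxA rjy !mulmx0 subr0.
  by rewrite mulmxA mulmxBr ux mulmxA mul_delta_col -scalar_mxM -raddfB -scalar_mxM.
apply: (cprod_of_conj Ezeta); apply: (cprod_of_conj Exi); rewrite -/tau.
have P1 := cprod_shear_row_value ij kl a n3 ftj (delta_row_mul0 riy) (delta_row_mul0 rjy).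
have P2 := cprod_shear_coef ij kl (a * u 0 i) b n3 ftj.
have := cprodM P1 P2; rewrite uy !mxE mulr1n transvectionD.
by rewrite !mulrA -mulrDl mulrBr mulrA subrK.
Qed.

(** The difference is read off the entry (j, i) of the conjugate of sigma by
    t_ji(c), at the cost of the two off-diagonal entries it also involves. *)
Lemma cprod_diag s sigma i j k l (ij : i != j) (kl : k != l) (a b c : R) :
    (3 <= n)%N -> stable_range R s -> (s < n)%N ->
  product_of_En_conjugates 48 sigma
    (transvection kl (a * (c * sigma i i - sigma j j * c) * b)).
Proof.
move=> n3 srR ltsn.
have ji : j != i by rewrite eq_sym.
pose t := transvection ji c.
have Et : En t by apply: generated_gen; exists j, i, ji, c.
have tE : (sigma ^ t)%g j i =
    sigma j i + sigma j j * c - c * sigma i i - c * sigma i j * c.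
  have entry (M : 'M[R]_n) p q : 'r_p *m M *m 'c_q = (M p q)%:M.
    by rewrite mul_delta_col -rowE mxE.
  have rjt : 'r_j *m GL_mx t^-1%g = 'r_j - c%:M *m 'r_i.
    rewrite /t transvection_rank1 rank1V ?rank1_mx ?mulmxN ?mulmxA;
      rewrite ?(delta_row_colN ij) ?mul0mx ?oppr0 //.
    by rewrite mulmxDr mulmx1 mulNmx mulmxN !mulmxA delta_row_col eqxx mul1mx.
  have tci : GL_mx t *m 'c_i = 'c_i + 'c_j *m c%:M.
    rewrite /t transvection_rank1 rank1_mx ?mulmxA ?(delta_row_colN ij) ?mul0mx //.
    by rewrite mulmxDl mul1mx -(mulmxA _ 'r_i) delta_row_col eqxx mulmx1.
  have entryl p q : c%:M *m 'r_p *m sigma *m 'c_q = (c * sigma p q)%:M.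
    by rewrite -!mulmxA (mulmxA 'r_p) entry -scalar_mxM.
  have := entry (sigma ^ t)%g j i; rewrite conjgE 2!GL_mxM mulmxA rjt.
  rewrite -mulmxA -mulmxA tci mulmxA mulmxDr mulmxA !mulmxBl !entry !entryl -!scalar_mxM.
  move=> /matrixP/(_ 0 0); rewrite !mxE !mulr1n => <-.
  by rewrite addrACA addrA.
have P1 := cprod_offdiag sigma ji kl a b n3 srR ltsn.
have P2 := cprod_offdiag sigma ij kl (- a * c) (c * b) n3 srR ltsn.
have P3 := cprod_of_conj Et (cprod_offdiag (sigma ^ t)%g ji kl (- a) b n3 srR ltsn).
have := cprodM (cprodM P1 P2) P3; rewrite !transvectionD.
congr (product_of_En_conjugates _ _ (transvection _ _)).
rewrite tE !mulNr !mulrDr !mulrDl !mulrN !mulNr !mulrA.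
set P := _ * sigma j i * b; set Q := a * c * sigma i j * c * b.
set C := a * sigma j j * c * b; set D := a * c * sigma i i * b.
have -> : P + C - D - Q = (P - Q) + (C - D) by rewrite addrACA [- Q - D]addrC addrA.
by rewrite opprD addrA subrr add0r opprB.
Qed.
End Coordinates.

Theorem theorem19 (n : nat) (hn : (3 <= n)%N) (R : nzRingType) (s : nat)
    (hs : sr_eq R s) (hs1 : (1 < s)%N) (hsn : (s < n)%N)
    (sigma : GL R n) (i j k l : 'I_n) (neq_ij : i != j) (neq_kl : k != l)
    (a b c : R) :
  product_of_En_conjugates 16 sigma
    (transvection neq_kl (a * sigma i j * b)) /\
  product_of_En_conjugates 48 sigma
    (transvection neq_kl (a * (c * sigma i i - sigma j j * c) * b)).
Proof.
have [_ srR _] := hs.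
by split; [exact: (@cprod_offdiag R n s) | exact: (@cprod_diag R n s)].
Qed.
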